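(* The complete graph on $n$ nodes is a $(\phi,\alpha)$-vertex expander for every $0<\phi\le n-1$ and $\alpha\le\tfrac{1}{1+\phi}$.
   Context: Graphs are finite, simple, undirected and unweighted. For $S\subseteq V$ let $N(S)=\{v\in V:\exists s\in S,\ \{s,v\}\in E\}$ and $\partial S=N(S)\setminus S$. For $\phi\in(0,n)$ and $\alpha\in(0,\tfrac12]$, a graph $G=(V,E)$ with $n$ nodes is a $(\phi,\alpha)$-(vertex) expander if $|\partial S|\ge \phi|S|$ for every $S\subseteq V$ with $0<|S|\le\alpha n$. *)

(* Defs.v *)
From mathcomp Require Import all_boot all_order all_algebra.

Set Implicit Arguments.
Unset Strict Implicit.
Unset Printing Implicit Defensive.

Import Order.TTheory GRing.Theory Num.Theory.

Record sgraph (V : finType) := SGraph {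
  adj : rel V;
  adj_sym : symmetric adj;
  adj_irr : irreflexive adj
}.

Definition nbh (V : finType) (G : sgraph V) (S : {set V}) : {set V} :=
  [set v | [exists s in S, adj G s v]].

Definition vboundary (V : finType) (G : sgraph V) (S : {set V}) : {set V} :=
  nbh G S :\: S.

Local Open Scope ring_scope.

(* The notion is only meant for 0 < phi < #|V| and 0 < alpha <= 1/2; these
   ranges are left as hypotheses of the statements that use it. *)
Definition vertex_expander (R : realFieldType) (V : finType) (G : sgraph V)
    (phi alpha : R) : Prop :=
  forall S : {set V}, (0 < #|S|)%N -> #|S|%:R <= alpha * #|V|%:R ->
    phi * #|S|%:R <= #|vboundary G S|%:R.

Lemma neq_sym (V : finType) : symmetric [rel x y : V | x != y].
Proof. by move=> x y /=; rewrite eq_sym. Qed.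

Lemma neq_irr (V : finType) : irreflexive [rel x y : V | x != y].
Proof. by move=> x /=; rewrite eqxx. Qed.

Definition complete_graph (V : finType) : sgraph V :=
  SGraph (@neq_sym V) (@neq_irr V).

(* Main.v *)
Require Import Defs.
From mathcomp Require Import all_boot all_order all_algebra.

Set Implicit Arguments.
Unset Strict Implicit.
Unset Printing Implicit Defensive.

Import Order.TTheory GRing.Theory Num.Theory.
Local Open Scope ring_scope.

(** In a complete graph every vertex outside a nonempty [S] is a neighbour of [S], so the boundary
    is the whole complement ([vboundary_complete]). Expansion then reads
    [phi * #|S| <= #|V| - #|S|], that is [#|S| <= #|V| / (1 + phi)], which the size bound on [S] and
    [alpha <= 1 / (1 + phi)] give. *)

Lemma vboundary_complete (V : finType) (S : {set V}) :
  S != set0 -> vboundary (complete_graph V) S = ~: S.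
Proof.
case/set0Pn=> s sS; apply/setP=> v; rewrite !inE.
have [//|vS] /= := boolP (v \in S).
(* Any [s] in [S] works: [v] lies outside [S], hence differs from [s]. *)
apply/existsP; exists s; rewrite sS /=.
by apply: contraNneq vS => <-.
Qed.

Theorem lemma4p5 (R : realFieldType) (n : nat) (V : finType) (cardV : #|V| = n)
    (phi alpha : R) (phi_gt0 : 0 < phi) (phi_le : phi <= n%:R - 1)
    (alpha_gt0 : 0 < alpha) (alpha_le_half : alpha <= 1 / 2)
    (alpha_le : alpha <= 1 / (1 + phi)) :
  vertex_expander (complete_graph V) phi alpha.
Proof.
move=> S S_gt0 S_le; rewrite vboundary_complete -?card_gt0 //.
have phi1_gt0 : 0 < 1 + phi by rewrite addr_gt0.
(* Adding [#|S|] to both sides turns the goal into [(1 + phi) * #|S| <= #|V|]. *)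
rewrite -(lerD2l #|S|%:R) -natrD cardsC -[X in X + _]mul1r -mulrDl.
rewrite mulrC -ler_pdivlMr // mulrC -[_^-1]div1r.
by apply: le_trans S_le _; rewrite ler_wpM2r.
Qed.
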